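(* Let $M$ be a smooth manifold, $r\ge 0$ an integer, $(\tau,\omega)$ a doublet of class $2r+1$ on $M$ with $\tau\in\Omega^1(M)$ and $\omega\in\Omega^2(M)$, and $f\in C^\infty(M)$. Then the pair $(e^f\tau,\ e^f(df\wedge\tau+\omega))$ is a doublet of class $2r+1$ if, and only if, $$\mathscr L_\Gamma f=0$$ for every $\Gamma\in\mathcal K_{(\tau,\omega)}=\operatorname{Ker}\tau\cap\operatorname{Ker}\omega$.
   Context: For a $p$-form $\alpha$, $\operatorname{Ker}\alpha_x=\{v\in T_xM\mid\iota_v\alpha_x=0\}$. The characteristic distribution of a pair $(\tau,\omega)$ is $\mathcal K_{(\tau,\omega)_x}=\operatorname{Ker}\tau_x\cap\operatorname{Ker}\omega_x$, and its codimension in $T_xM$ is the class of the pair at $x$. A doublet is a pair whose class is constant on $M$. $\Gamma\in\mathcal K_{(\tau,\omega)}$ means that $\Gamma$ is a vector field on $M$ taking values in $\mathcal K_{(\tau,\omega)}$; $\mathscr L$ denotes the Lie derivative. *)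

(* Defs.v *)
From HB Require Import structures.
From mathcomp Require Import all_boot all_order all_algebra.
From mathcomp Require Import all_classical all_reals all_analysis.
Import Order.TTheory GRing.Theory Num.Theory.
From mathcomp Require Import ring.
Import numFieldNormedType.Exports.

Set Implicit Arguments.
Unset Strict Implicit.
Unset Printing Implicit Defensive.

Local Open Scope classical_set_scope.
Local Open Scope ring_scope.

(* Only meant for [U] open: ['d f x] is the Frechet differential on the whole
   space, and f is C^(k+1) when x |-> 'd f x is C^k direction by direction. *)
Fixpoint Ck (R : realType) (n : nat) (W : normedModType R) (k : nat)
    (U : set 'rV[R]_n) (f : 'rV[R]_n -> W) : Prop :=
  match k with
  | 0 => forall x, U x -> {for x, continuous f}
  | k'.+1 => (forall x, U x -> differentiable f x) /\
             (forall v, Ck k' U (fun x => 'd f x v))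
  end.

Definition smooth_on (R : realType) (n : nat) (W : normedModType R)
    (U : set 'rV[R]_n) (f : 'rV[R]_n -> W) : Prop := forall k, Ck k U f.

(* [cmap] and [cinv] are total, but only meaningful on [cdom] and on
   [cmap @` cdom] respectively. *)
Record chart (R : realType) (n : nat) (M : topologicalType) := Chart {
  cdom : set M;
  cmap :> M -> 'rV[R]_n;
  cinv : 'rV[R]_n -> M;
  cdom_open : open cdom;
  cimg_open : open (cmap @` cdom);
  cmapK : forall x, cdom x -> cinv (cmap x) = x;
  cmap_continuous : forall x, cdom x -> {for x, continuous cmap};
  cinv_continuous :
    forall y, (cmap @` cdom) y -> {for y, continuous cinv} }.

Definition cimg (R : realType) (n : nat) (M : topologicalType)
  (c : chart R n M) : set 'rV[R]_n := c @` cdom c.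

Definition transition (R : realType) (n : nat) (M : topologicalType)
  (c d : chart R n M) : 'rV[R]_n -> 'rV[R]_n := fun y => d (cinv c y).

(* The smooth structure is given by an atlas, which need not be maximal. *)
Record manifold (R : realType) (n : nat) := Manifold {
  carrier :> topologicalType;
  carrier_hausdorff : hausdorff_space carrier;
  carrier_second_countable : @second_countable carrier;
  atlas : set (chart R n carrier);
  atlas_cover : forall x, exists c, atlas c /\ cdom c x;
  atlas_compat : forall c d, atlas c -> atlas d ->
    smooth_on (c @` (cdom c `&` cdom d)) (transition c d) }.

Lemma near_eq_diff (R : realType) (V W : normedModType R) (f g : V -> W) x :
  (\forall y \near x, f y = g y) -> differentiable f x ->
  differentiable g x /\ 'd g x = 'd f x :> (V -> W).
Proof.
move=> fg df; have fgx : f x = g x := nbhs_singleton fg.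
have gE : g \o shift x = cst (g x) + 'd f x +o_ 0 id.
  apply/eqaddoP => e e0; have /eqaddoP /(_ e e0) := diff_locally df.
  have fg0 : \forall h \near 0, f (h + x) = g (h + x).
    by move: fg; rewrite (near_shift 0 x) subr0.
  by apply: filterS2 fg0 => h fgh; rewrite !fctE /= fgh fgx.
have dE : 'd g x = 'd f x :> (V -> W).
  by apply: diff_unique gE; exact: diff_continuous.
by split=> //; apply/diff_locallyP; rewrite dE; split=> //; exact: diff_continuous.
Qed.

(* (a /\ b)(u, v) = a u * b v - a v * b u, as a linear map u |-> (a /\ b)(u, _). *)
Section wedge.
Context {R : realType} {V : vectType R}.
Implicit Types (a b : 'Hom(V, R^o)) (u v : V).

Definition wedge_fun a b u : 'Hom(V, R^o) := a u *: b - b u *: a.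

Lemma wedge_fun_linear a b : linear (wedge_fun a b).
Proof.
move=> k u v; apply/lfunP => w; rewrite /wedge_fun !lfun_simp !linearP /=.
rewrite /GRing.scale /=; ring.
Qed.

HB.instance Definition _ a b :=
  GRing.isLinear.Build R V 'Hom(V, R^o) _ (wedge_fun a b) (wedge_fun_linear a b).

Definition wedge a b : 'Hom(V, 'Hom(V, R^o)) := linfun (wedge_fun a b).

Lemma wedgeE a b u v : wedge a b u v = a u * b v - a v * b u.
Proof. by rewrite lfunE /= /wedge_fun !lfun_simp; congr (_ - _); exact: mulrC. Qed.

End wedge.

Section tangent_space.
Context {R : realType} {n : nat} {M : manifold R n}.
Implicit Types (x : M) (c d e : chart R n M).

Definition chart_around x c : Prop := atlas c /\ cdom c x.

(* A tangent vector at x is the family of its coordinates in all the charts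
   around x, related by the differentials of the transition maps; the value 0
   on the other charts makes the family unique. *)
Definition is_tangent x (v : chart R n M -> 'rV[R]_n) : Prop :=
  (forall c, ~ chart_around x c -> v c = 0) /\
  (forall c d, chart_around x c -> chart_around x d ->
     v d = 'd (transition c d) (c x) (v c)).

Definition tangent_pred x : {pred chart R n M -> 'rV[R]_n} :=
  fun v => `[< is_tangent x v >].

Record tangent x := Tangent {
  coords :> chart R n M -> 'rV[R]_n;
  _ : coords \in tangent_pred x }.

Lemma tangent_submod_closed x : submod_closed (tangent_pred x).
Proof.
split; first by apply/asboolP; split=> // c d _ _; rewrite linear0.
move=> a u v /asboolP [u0 uE] /asboolP [v0 vE]; apply/asboolP; split=> [c nc|c d hc hd].
  by rewrite !fctE u0 // v0 // scaler0 addr0.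
by rewrite !fctE linearP -uE // -vE.
Qed.

HB.instance Definition _ x :=
  GRing.isSubmodClosed.Build _ _ (tangent_pred x) (tangent_submod_closed x).
HB.instance Definition _ x := [isSub for @coords x].
HB.instance Definition _ x := [Choice of tangent x by <:].
HB.instance Definition _ x := [SubChoice_isSubLmodule of tangent x by <:].

Lemma smooth_on_differentiable (W : normedModType R) (U : set 'rV[R]_n)
    (f : 'rV[R]_n -> W) y : smooth_on U f -> U y -> differentiable f y.
Proof. by move=> /(_ 1) [df _]; exact: df. Qed.

Lemma near_chart x c d : chart_around x c -> chart_around x d ->
  \forall y \near c x, cdom d (cinv c y).
Proof.
move=> [_ cx] [_ dx]; have ccx : cimg c (c x) by exists x.
apply: (cinv_continuous ccx); rewrite cmapK //.
by apply: open_nbhs_nbhs; split => //; exact: cdom_open.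
Qed.

Lemma differentiable_transition x c d : chart_around x c -> chart_around x d ->
  differentiable (transition c d) (c x).
Proof.
move=> [ac cx] [ad dx].
by apply: smooth_on_differentiable (atlas_compat ac ad) _; exists x.
Qed.

Lemma diff_transition_id x c : chart_around x c ->
  'd (transition c c) (c x) = id :> ('rV[R]_n -> 'rV[R]_n).
Proof.
move=> [ac cx]; have [dI dIE] := is_diff_id (c x).
have [|_ ->] // := @near_eq_diff R _ _ id (transition c c) (c x) _ dI.
have : \forall y \near c x, cimg c y.
  by apply: open_nbhs_nbhs; split; [exact: cimg_open | exists x].
by apply: filterS => _ [z cz <-]; rewrite /transition cmapK.
Qed.

Lemma diff_transition_comp x c d e w :
  chart_around x c -> chart_around x d -> chart_around x e ->
  'd (transition c e) (c x) w =
  'd (transition d e) (d x) ('d (transition c d) (c x) w).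
Proof.
move=> hc hd he; have tcx : transition c d (c x) = d x.
  by rewrite /transition cmapK //; case: hc.
have dcd := differentiable_transition hc hd.
have dde := differentiable_transition hd he.
have dde' : differentiable (transition d e) (transition c d (c x)) by rewrite tcx.
have dce : differentiable (transition d e \o transition c d) (c x).
  exact: differentiable_comp.
have nce : \forall y \near c x,
    (transition d e \o transition c d) y = transition c e y.
  apply: filterS (near_chart hc hd) => y dy.
  by rewrite /transition /comp cmapK.
have [_ E] := near_eq_diff nce dce.
rewrite -tcx; exact: etrans (congr1 (@^~ w) E)
  (congr1 (@^~ w) (diff_comp dcd dde')).
Qed.

Lemma tangentP x (v : tangent x) : is_tangent x v.
Proof. by case: v => v /= /asboolP. Qed.

Lemma tangent_eqP x c (v w : tangent x) : chart_around x c -> v c = w c -> v = w.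
Proof.
move=> hc vw; apply: val_inj; apply/funext => d /=.
have [v0 vE] := tangentP v; have [w0 wE] := tangentP w.
have [hd|nd] := pselect (chart_around x d); last by rewrite v0 ?w0.
by rewrite (vE c d hc hd) (wE c d hc hd) vw.
Qed.

Definition lift_family x c (w : 'rV[R]_n) : chart R n M -> 'rV[R]_n :=
  fun d => if `[< chart_around x c /\ chart_around x d >]
           then 'd (transition c d) (c x) w else 0.

Lemma lift_family_tangent x c w : lift_family x c w \in tangent_pred x.
Proof.
apply/asboolP; split=> [d nd|d e hd he]; rewrite /lift_family.
  by case: asboolP => // -[].
case: asboolP => [[hc _]|nc]; last first.
  by case: asboolP => [[hc _]|_]; [case: nc | rewrite linear0].
by case: asboolP => [_|[]//]; exact: diff_transition_comp.
Qed.

(* The tangent vector at x with coordinates w in the chart c around x (and 0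
   when c is not a chart around x). *)
Definition tangent_of x c (w : 'rV[R]_n) : tangent x :=
  Tangent (lift_family_tangent x c w).

Lemma tangent_ofE x c w : chart_around x c -> tangent_of x c w c = w.
Proof.
move=> hc; rewrite /= /lift_family asboolT // diff_transition_id //.
Qed.

Definition chart_at x : chart R n M := sval (cid (atlas_cover x)).

Lemma chart_atP x : chart_around x (chart_at x).
Proof. by rewrite /chart_at; case: cid. Qed.

Lemma tangent_vect_axiom x : Vector.axiom n (tangent x).
Proof.
exists (fun v : tangent x => v (chart_at x)); first by [].
exists (tangent_of x (chart_at x)) => [v|w]; last exact: tangent_ofE (chart_atP x).
by apply: (tangent_eqP (chart_atP x)); rewrite tangent_ofE //; exact: chart_atP.
Qed.

HB.instance Definition _ x :=
  Lmodule_hasFinDim.Build R (tangent x) (tangent_vect_axiom x).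

Lemma dim_tangent x : \dim {:tangent x} = n.
Proof. exact: dimvf. Qed.

End tangent_space.

Section forms.
Context {R : realType} {n : nat} {M : manifold R n}.

(* The coordinate vector field d/dc^i at a point x of the domain of c. *)
Definition coord_vect (c : chart R n M) (i : 'I_n) (x : M) : tangent x :=
  tangent_of x c (delta_mx 0 i).

Definition one_form := forall x : M, 'Hom(tangent x, R^o).

(* [om x u] is the contraction of [om x] with u, so that [om x u v] is the value
   of the form on (u, v); antisymmetry is part of [smooth_two_form]. *)
Definition two_form := forall x : M, 'Hom(tangent x, 'Hom(tangent x, R^o)).

Definition vector_field := forall x : M, tangent x.

Definition smooth_function (f : M -> R) : Prop :=
  forall c, atlas c -> smooth_on (cimg c) (fun y => f (cinv c y)).

Definition smooth_vector_field (X : vector_field) : Prop :=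
  forall c, atlas c -> smooth_on (cimg c) (fun y => X (cinv c y) c).

Definition smooth_one_form (tau : one_form) : Prop :=
  forall c, atlas c -> forall i,
    smooth_on (cimg c) (fun y => tau (cinv c y) (coord_vect c i (cinv c y))).

Definition smooth_two_form (om : two_form) : Prop :=
  (forall x u, om x u u = 0) /\
  forall c, atlas c -> forall i j,
    smooth_on (cimg c) (fun y =>
      om (cinv c y) (coord_vect c i (cinv c y)) (coord_vect c j (cinv c y))).

(* df_x(v), read in the chosen chart around x; see [differentialE] for the
   independence of the chart. *)
Definition differential_fun (f : M -> R) (x : M) (v : tangent x) : R^o :=
  'd (fun y => f (cinv (chart_at x) y) : R^o) (chart_at x x) (v (chart_at x)).

Lemma differential_fun_linear f x : linear (@differential_fun f x).
Proof. by move=> k u v; rewrite /differential_fun linearP. Qed.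

HB.instance Definition _ f x :=
  GRing.isLinear.Build R (tangent x) R^o _ (@differential_fun f x)
    (@differential_fun_linear f x).

Definition differential (f : M -> R) : one_form :=
  fun x => linfun (@differential_fun f x).

Lemma differentialE f x c (v : tangent x) :
  smooth_function f -> chart_around x c ->
  differential f x v = 'd (fun y => f (cinv c y) : R^o) (c x) (v c).
Proof.
move=> sf hc; rewrite lfunE /= /differential_fun.
set d := chart_at x; have hd : chart_around x d := chart_atP x.
have [_ vE] := tangentP v; rewrite (vE c d hc hd).
have tcx : transition c d (c x) = d x by rewrite /transition cmapK //; case: hc.
have df : differentiable (fun y => f (cinv d y) : R^o) (transition c d (c x)).
  rewrite tcx; case: hd => ad dx.
  by apply: smooth_on_differentiable (sf d ad) _; exists x.
have dcd := differentiable_transition hc hd.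
have dfcd : differentiable ((fun y => f (cinv d y) : R^o) \o transition c d) (c x).
  exact: differentiable_comp.
have near_f : \forall y \near c x,
    ((fun y => f (cinv d y) : R^o) \o transition c d) y = f (cinv c y).
  apply: filterS (near_chart hc hd) => y dy.
  by rewrite /transition /comp cmapK.
have [_ E] := near_eq_diff near_f dfcd.
rewrite -tcx; apply/esym; exact: etrans (congr1 (@^~ (v c)) E)
  (congr1 (@^~ (v c)) (diff_comp dcd df)).
Qed.

Definition lie_derivative (X : vector_field) (f : M -> R) : M -> R :=
  fun x => differential f x (X x).

(* As [om x v] is the contraction of [om x] with v, and [tau x v] that of [tau x],
   Ker tau_x and Ker om_x are the kernels of these linear maps. *)
Definition char_distribution (tau : one_form) (om : two_form) (x : M) :
  {vspace tangent x} := (lker (tau x) :&: lker (om x))%VS.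

Definition pair_class (tau : one_form) (om : two_form) (x : M) : nat :=
  (\dim {:tangent x} - \dim (char_distribution tau om x))%N.

Definition doublet_of_class (k : nat) (tau : one_form) (om : two_form) : Prop :=
  [/\ smooth_one_form tau, smooth_two_form om &
      forall x, pair_class tau om x = k].

End forms.

Arguments one_form {R n} M.
Arguments two_form {R n} M.
Arguments vector_field {R n} M.

(* Main.v *)
Require Import Defs.
From HB Require Import structures.
From mathcomp Require Import all_boot all_order all_algebra.
From mathcomp Require Import all_classical all_reals all_analysis.
From mathcomp Require Import ring lra.
Import Order.TTheory GRing.Theory Num.Theory.
Import numFieldNormedType.Exports.

Set Implicit Arguments.
Unset Strict Implicit.
Unset Printing Implicit Defensive.

Local Open Scope classical_set_scope.
Local Open Scope ring_scope.

(** Write K for the characteristic distribution of (tau, omega) and K' for that of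
(e^f tau, e^f (df /\ tau + omega)). The heart of the matter is the pointwise
identity K' = K cap Ker df ([ker_perturbed]). A vector v is in K' when tau(v) = 0
and df(v) tau + i_v omega = 0. Since the class is odd and the rank of an
antisymmetric matrix is even, there is a Reeb vector z with i_z omega = 0 and
tau(z) != 0 ([exists_reeb]); evaluating the equation on z gives df(v) = 0, and
then i_v omega = 0. The converse inclusion is immediate.

Hence the new pair has the same class at every point if and only if df vanishes
on K. That its forms are smooth follows from the rules of differentiation.

It remains to compare df = 0 on K with L_Gamma f = 0 for the smooth sections
Gamma of K. The former clearly implies the latter; for the converse, every vector
v of K at x0 must extend, up to a nonzero factor, to a global smooth section
([char_section]). In a chart, K is the left kernel of a matrix A(y) of constant
rank k; choosing constant matrices N and L with N A L the identity at x0, Cramer's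
rule corrects the constant vector v into a vector of Ker A(y) depending
polynomially on A(y) ([kernel_vect]). Multiplying by a bump function made from
exp(-1/t) and extending by zero produces the section; the extension is smooth
because M is Hausdorff ([extend_smooth]). *)

(** * Pairs of odd class in linear algebra *)

Section reeb.
Context {R : numFieldType} {V : vectType R}.
Implicit Types (t : 'Hom(V, R^o)) (o : 'Hom(V, 'Hom(V, R^o))).

Lemma alt_antisym o : (forall u, o u u = 0) -> forall u v, o u v = - o v u.
Proof.
move=> alt u v; apply/eqP; rewrite -addr_eq0; apply/eqP.
by have := alt (u + v); rewrite !linearD /= !add_lfunE !alt add0r addr0 addrC.
Qed.

Lemma det_antisym_odd k (A : 'M[R]_k) : odd k -> A^T = - A -> \det A = 0.
Proof.
move=> ok AT; have := det_tr A; rewrite AT -scaleN1r detZ -signr_odd ok expr1 mulN1r.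
by move/eqP; rewrite eq_sym -addr_eq0 -mulr2n mulrn_eq0 => /eqP.
Qed.

(** The Reeb vector of a pair of odd class. On a complement of the common kernel,
which has odd dimension, o is given by an antisymmetric matrix of odd size, hence
has a nonzero kernel vector z; as z is outside the common kernel, t z != 0. *)
Lemma exists_reeb t o : (forall u, o u u = 0) ->
  odd (\dim {:V} - \dim (lker t :&: lker o)) ->
  exists2 z, o z = 0 & t z != 0.
Proof.
move=> alt; have anti := alt_antisym alt.
set K := (lker t :&: lker o)%VS; rewrite -dimv_compl => odd_k.
set b := vbasis (K^C).
pose A : 'M[R]_(\dim (K^C)) := \matrix_(i, j) o b`_i b`_j.
have : \det A == 0.
  rewrite det_antisym_odd //; apply/matrixP => i j; rewrite !mxE; exact: anti.
move/det0P => [w w0 wA].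
pose z := \sum_i w 0 i *: b`_i.
have zK' : z \in (K^C)%VS.
  by apply: memv_suml => i _; apply/memvZ/vbasis_mem/mem_nth; rewrite size_tuple.
have ozb (j : 'I_(\dim (K^C))) : o z b`_j = 0.
  have := congr1 (fun B : 'rV_ _ => B 0 j) wA; rewrite !mxE => <-.
  rewrite linear_sum sum_lfunE; apply: eq_bigr => i _.
  by rewrite linearZ /= scale_lfunE !mxE.
have oz : o z = 0.
  apply/lfunP => v; rewrite [RHS]zero_lfunE.
  have : v \in (K + K^C)%VS by rewrite addv_complf memvf.
  move/memv_addP => [k Kk [u Ku ->]]; rewrite linearD /=.
  have /andP[_ ok] : (k \in lker t) && (k \in lker o) by rewrite -memv_cap.
  rewrite anti; move: ok; rewrite memv_ker => /eqP ->; rewrite zero_lfunE oppr0 add0r.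
  rewrite (coord_vbasis Ku) linear_sum big1 // => i _.
  by rewrite linearZ /= ozb scaler0.
exists z => //; apply: contra w0 => tz.
have zK : z \in K by rewrite memv_cap !memv_ker tz oz eqxx.
have : z \in (K :&: K^C)%VS by rewrite memv_cap zK zK'.
rewrite capv_compl memv0 => /eqP z0; apply/eqP/rowP => i; rewrite mxE.
have /freeP fb := basis_free (vbasisP (K^C)).
exact: (fb (fun i => w 0 i) z0 i).
Qed.

End reeb.

(** If t v = 0 and d v . t + o v = 0, evaluating on a vector z with o z = 0 and
t z != 0 leaves d v * t z = 0, by antisymmetry of o; hence d v = 0 and then
o v = 0. This is where odd class is indispensable: with t = o u the vector v = u
could satisfy the equation with d v = -1. *)
Lemma ker_perturbed (R : realType) (V : vectType R) (t d : 'Hom(V, R^o))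
    (o : 'Hom(V, 'Hom(V, R^o))) (c : R) : c != 0 -> (forall u, o u u = 0) ->
  odd (\dim {:V} - \dim (lker t :&: lker o)) ->
  (lker (c *: t) :&: lker (c *: (wedge d t + o)) = 
   (lker t :&: lker o) :&: lker d)%VS.
Proof.
move=> c0 alt odd_k; have [z oz tz] := exists_reeb alt odd_k.
apply/vspaceP => v; rewrite !memv_cap !memv_ker !scale_lfunE !scaler_eq0 (negPf c0) /=.
rewrite add_lfunE lfunE /=.
have [tv|] := eqVneq (t v) 0 => //=.
have wE : wedge_fun d t v = d v *: t by rewrite /wedge_fun tv scale0r subr0.
rewrite wE; apply/eqP/andP => [E|[/eqP -> /eqP ->]]; last by rewrite scale0r addr0.
have dv : d v = 0.
  have := congr1 (fun h : 'Hom(V, R^o) => h z) E; rewrite add_lfunE scale_lfunE zero_lfunE.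
  rewrite (alt_antisym alt) oz zero_lfunE oppr0 addr0 => /eqP.
  by rewrite scaler_eq0 (negPf tz) orbF => /eqP.
by move: E; rewrite dv scale0r add0r => ->.
Qed.

(** * Calculus of C^k maps on open sets *)

Section Ck_calculus.
Context {R : realType} {n : nat}.
Implicit Types (U : set 'rV[R]_n) (k : nat).

Lemma near_eq_continuous (T S : topologicalType) (f g : T -> S) x :
  (\forall y \near x, f y = g y) -> {for x, continuous f} ->
  {for x, continuous g}.
Proof.
move=> fg fc; rewrite /prop_for /continuous_at -(nbhs_singleton fg).
by apply: cvg_trans fc; apply: near_eq_cvg; apply: filterS fg => y ->.
Qed.

Lemma near_open (P : 'rV[R]_n -> Prop) U x : open U -> U x ->
  (forall y, U y -> P y) -> \forall y \near x, P y.
Proof.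
move=> oU Ux UP; have : \forall y \near x, U y by exact: open_nbhs_nbhs.
exact: filterS.
Qed.

Lemma Ck_ext (W : normedModType R) k U (f g : 'rV[R]_n -> W) : open U ->
  (forall x, U x -> f x = g x) -> Ck k U f -> Ck k U g.
Proof.
move=> oU; elim: k f g => [|k IH] f g fg /=.
  move=> cf x Ux; apply: (@near_eq_continuous _ _ f); last exact: cf.
  exact: near_open oU Ux fg.
move=> [df dfk]; split=> [x Ux|v].
  by have [] := near_eq_diff (near_open oU Ux fg) (df x Ux).
apply: IH (dfk v) => x Ux.
have [_ E] := near_eq_diff (near_open oU Ux fg) (df x Ux).
exact: (congr1 (@^~ v) (esym E)).
Qed.

(** The sets V may be arbitrary, because the differential is taken in the whole
space; so the V found for f serves for its directional derivatives as well. *)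
Lemma Ck_local (W : normedModType R) k U (f : 'rV[R]_n -> W) :
  (forall x, U x -> exists2 V, V x & Ck k V f) -> Ck k U f.
Proof.
elim: k f => [|k IH] f loc /=.
  by move=> x /loc [V Vx fV]; exact: fV x Vx.
split=> [x /loc [V Vx [fV _]]|v]; first exact: fV x Vx.
by apply: IH => x /loc [V Vx [_ fV]]; exists V; last exact: fV.
Qed.

Lemma Ck_sub (W : normedModType R) k U V (f : 'rV[R]_n -> W) :
  U `<=` V -> Ck k V f -> Ck k U f.
Proof. by move=> UV fV; apply: Ck_local => x /UV Vx; exists V. Qed.

Lemma CkW (W : normedModType R) k U (f : 'rV[R]_n -> W) :
  Ck k.+1 U f -> Ck k U f.
Proof.
elim: k f => [|k IH] f [df dfk].
  by move=> x Ux; apply: differentiable_continuous; exact: df.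
by split=> // v; apply: IH; exact: dfk.
Qed.

Lemma Ck_cst (W : normedModType R) k U (a : W) : Ck k U (fun=> a).
Proof.
elim: k a => [|k IH] a /=; first by move=> x _; exact: cst_continuous.
split=> [x _|v]; first exact: differentiable_cst.
rewrite (_ : (fun x => _) = fun=> 0); first exact: IH.
by apply/funext => x; rewrite diff_cst.
Qed.

(** This lets the differential be given by the formula df that the rules of
differentiation produce, valid on U only. *)
Lemma CkS (W : normedModType R) k U (f : 'rV[R]_n -> W)
    (df : 'rV[R]_n -> 'rV[R]_n -> W) : open U ->
  (forall x, U x -> is_diff x f (df x)) ->
  (forall v, Ck k U (fun x => df x v)) -> Ck k.+1 U f.
Proof.
move=> oU fdf Cdf; split=> [x Ux|v]; first by case: (fdf x Ux).
by apply: Ck_ext (Cdf v) => // x Ux; case: (fdf x Ux) => _ ->.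
Qed.

Lemma CkD (W : normedModType R) k U (f g : 'rV[R]_n -> W) : open U ->
  Ck k U f -> Ck k U g -> Ck k U (fun x => f x + g x).
Proof.
move=> oU; elim: k f g => [|k IH] f g.
  by move=> cf cg x Ux; apply: continuousD; [exact: cf|exact: cg].
move=> [df dfk] [dg dgk].
apply: (@CkS _ _ _ _ (fun x => ('d f x : _ -> _) + 'd g x)) => // [x Ux|v].
  by apply: is_diffD; apply: differentiableP; [exact: df|exact: dg].
exact: IH (dfk v) (dgk v).
Qed.

Lemma CkZl (W : normedModType R) k U (a : 'rV[R]_n -> R) (w : W) : open U ->
  Ck k U a -> Ck k U (fun x => a x *: w).
Proof.
move=> oU; elim: k a => [|k IH] a.
  by move=> ca x Ux; apply: continuousZr_tmp; exact: ca.
move=> [da dak].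
apply: (@CkS _ _ _ _ (fun x v => 'd a x v *: w)) => // [x Ux|v].
  by split; [exact/differentiableZl/da|exact/diffZl/da].
exact: IH (dak v).
Qed.

Lemma CkM k U (f g : 'rV[R]_n -> R) : open U ->
  Ck k U f -> Ck k U g -> Ck k U (fun x => f x * g x).
Proof.
move=> oU; elim: k f g => [|k IH] f g.
  by move=> cf cg x Ux; apply: continuousM; [exact: cf|exact: cg].
move=> Cf Cg; have [df dfk] := Cf; have [dg dgk] := Cg.
apply: (@CkS R k U _ (fun x v => f x * 'd g x v + g x * 'd f x v) oU) => [x Ux|v].
  exact: (is_diffM (differentiableP (df x Ux)) (differentiableP (dg x Ux))).
exact: CkD oU (IH _ _ (CkW Cf) (dgk v)) (IH _ _ (CkW Cg) (dfk v)).
Qed.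

Lemma Ck_sum (W : normedModType R) k U (I : Type) (s : seq I) (P : pred I)
    (F : I -> 'rV[R]_n -> W) : open U ->
  (forall i, Ck k U (F i)) -> Ck k U (fun x => \sum_(i <- s | P i) F i x).
Proof.
move=> oU CF; elim: s => [|i s IH].
  by apply: Ck_ext (Ck_cst k U 0) => // x _; rewrite big_nil.
have [Pi|nPi] := boolP (P i).
  by apply: Ck_ext (CkD oU (CF i) IH) => // x _; rewrite big_cons Pi.
by apply: Ck_ext IH => // x _; rewrite big_cons (negPf nPi).
Qed.

Lemma Ck_prod k U (I : Type) (s : seq I) (P : pred I)
    (F : I -> 'rV[R]_n -> R) : open U ->
  (forall i, Ck k U (F i)) -> Ck k U (fun x => \prod_(i <- s | P i) F i x).
Proof.
move=> oU CF; elim: s => [|i s IH].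
  by apply: Ck_ext (Ck_cst k U (1 : R)) => // x _; rewrite big_nil.
have [Pi|nPi] := boolP (P i).
  by apply: Ck_ext (CkM oU (CF i) IH) => // x _; rewrite big_cons Pi.
by apply: Ck_ext IH => // x _; rewrite big_cons (negPf nPi).
Qed.

Lemma diff_coord m (i : 'I_m) (y : 'rV[R]_m) :
  'd (fun u : 'rV[R]_m => u 0 i : R) y = (fun u => u 0 i) :> ('rV[R]_m -> R).
Proof.
have @f : {linear 'rV[R]_m -> R}.
  by exists (fun u : 'rV[R]_m => u 0 i); do 2![eexists]; do ?[constructor];
     rewrite ?mxE// => ? *; rewrite ?mxE//; move=> ?; rewrite !mxE.
rewrite (_ : (fun _ => _) = f) //; apply: diff_lin; exact: coord_continuous.
Qed.

Lemma Ck_coord m k U (f : 'rV[R]_n -> 'rV[R]_m) i : open U ->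
  Ck k U f -> Ck k U (fun x => f x 0 i).
Proof.
move=> oU; elim: k f => [|k IH] f.
  move=> cf x Ux; apply: (@continuous_comp _ _ _ f (fun u : 'rV[R]_m => u 0 i)).
    exact: cf.
  exact: coord_continuous.
move=> [df dfk].
apply: (@CkS _ _ _ _ (fun x v => ('d f x v) 0 i)) => // [x Ux|v].
  apply: (@is_diff_comp _ _ _ _ f _ (fun u : 'rV[R]_m => u 0 i : R)
    (fun u : 'rV[R]_m => u 0 i : R)).
    exact/differentiableP/df.
  by split; [exact: differentiable_coord|exact: diff_coord].
exact: IH (dfk v).
Qed.

Lemma Ck_rV m k U (f : 'rV[R]_n -> 'rV[R]_m) : open U ->
  (forall i, Ck k U (fun x => f x 0 i)) -> Ck k U f.
Proof.
move=> oU Cf.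
apply: (@Ck_ext _ _ _ (fun x => \sum_i f x 0 i *: (delta_mx 0 i : 'rV[R]_m))) => //.
  by move=> x _; rewrite [RHS]row_sum_delta.
by apply: Ck_sum => // i; exact: CkZl.
Qed.

(** By the chain rule, the directional derivative of g o h is
sum_i (dh v)_i * (d_i g o h), to which the induction hypothesis applies because
only the constant directions e_i occur in the derivatives of g. *)
Lemma Ck_comp m k U V (g : 'rV[R]_m -> R) (h : 'rV[R]_n -> 'rV[R]_m) :
  open U -> (forall x, U x -> V (h x)) -> Ck k V g -> Ck k U h ->
  Ck k U (fun x => g (h x)).
Proof.
move=> oU UV; elim: k g => [|k IH] g.
  move=> cg ch x Ux; apply: (@continuous_comp _ _ _ h g); first exact: ch.
  exact: cg (UV _ Ux).
move=> [dg dgk] Ch; have [dh dhk] := Ch.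
apply: (@CkS _ _ _ _ (fun x v => 'd g (h x) ('d h x v))) => // [x Ux|v].
  apply: (@is_diff_comp _ _ _ _ h ('d h x) g ('d g (h x))).
    exact/differentiableP/dh.
  exact/differentiableP/dg/UV.
apply: (@Ck_ext _ _ _
  (fun x => \sum_i ('d h x v) 0 i * 'd g (h x) (delta_mx 0 i))) => //.
  move=> x Ux; rewrite [in RHS](row_sum_delta ('d h x v)) linear_sum.
  by apply: eq_bigr => i _; rewrite linearZ.
apply: Ck_sum => // i; apply: CkM => //; first exact: Ck_coord oU (dhk v).
exact: (IH (fun z => 'd g z (delta_mx 0 i)) (dgk _) (CkW Ch)).
Qed.

(** An outer function of one real variable, with its derivatives chained
explicitly: this fits families closed under differentiation, such as exp or
[flat] below. *)
Fixpoint Ck1 k (h : R -> R) : Prop :=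
  match k with
  | 0 => continuous h
  | k'.+1 => exists2 h' : R -> R,
      (forall t, is_derive t (1 : R) h (h' t)) & Ck1 k' h'
  end.

Lemma is_derive1_diff (h : R -> R) (t d : R) :
  is_derive t (1 : R) h d -> is_diff t h (fun s => s * d).
Proof.
move=> [dh <-]; split; first exact/derivable1_diffP.
by rewrite deriv1E // derive1E.
Qed.

Lemma Ck1_comp k U (h : R -> R) (u : 'rV[R]_n -> R) : open U ->
  Ck1 k h -> Ck k U u -> Ck k U (fun x => h (u x)).
Proof.
move=> oU; elim: k h => [|k IH] h.
  move=> ch cu x Ux; apply: (@continuous_comp _ _ _ u h); first exact: cu.
  exact: ch.
move=> [h' hh' Ch'] Cu; have [du duk] := Cu.
apply: (@CkS R k U _ (fun x v => 'd u x v * h' (u x)) oU) => [x Ux|v].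
  exact: (is_diff_comp (differentiableP (du x Ux)) (is_derive1_diff (hh' (u x)))).
exact: CkM oU (duk v) (IH _ Ch' (CkW Cu)).
Qed.

Lemma Ck1_expR k : Ck1 k (@expR R).
Proof.
elim: k => [|k IH]; first exact: continuous_expR.
by exists expR => // t; exact: is_derive_expR.
Qed.
End Ck_calculus.

(** * The flat function exp(-1/t) *)

Section flat.
Context {R : realType}.

(** t ^ (-k) * exp (-1/t) extended by 0 to t <= 0. The exponent k makes the family
closed under differentiation: flat_k' = flat_(k+2) - k flat_(k+1). *)
Definition flat (k : nat) (t : R) : R :=
  if 0 < t then t^-1 ^+ k * expR (- t^-1) else 0.

(** From exp s >= s ^ (k+2) / (k+2)! at s = 1/t. A quadratic bound is enough for
the derivative at 0 to exist and vanish. *)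
Lemma flat_le_sqr k t : `|flat k t| <= (k.+2)`!%:R * t ^+ 2.
Proof.
rewrite /flat; case: ifPn => [t0|_]; last by rewrite normr0 mulr_ge0 ?ler0n ?sqr_ge0.
have s0 : 0 < t^-1 by rewrite invr_gt0.
rewrite ger0_norm; last by rewrite mulr_ge0 ?expR_ge0 ?exprn_ge0 // ltW.
rewrite expRN ler_pdivrMr ?expR_gt0 //.
have := expR_ge1Dxn k.+1 (ltW s0).
have fact_pos : (0 : R) < (k.+2)`!%:R by rewrite ltr0n fact_gt0.
move=> expo; have {}expo : t^-1 ^+ k.+2 / (k.+2)`!%:R <= expR t^-1.
  by apply: le_trans expo; rewrite lerDr.
rewrite ler_pdivrMr // in expo.
have -> : t^-1 ^+ k = t ^+ 2 * t^-1 ^+ k.+2.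
  by rewrite -[k.+2]addn2 exprD mulrCA -exprMn divff ?expr1n ?mulr1 // gt_eqF.
by rewrite [leRHS]mulrAC [leLHS]mulrC ler_wpM2r ?sqr_ge0 // mulrC.
Qed.

Lemma flat_le0 k t : t <= 0 -> flat k t = 0.
Proof. by rewrite /flat leNgt => /negPf ->. Qed.

Lemma flat_gt0 k t : 0 < t -> 0 < flat k t.
Proof.
by move=> t0; rewrite /flat t0 mulr_gt0 ?expR_gt0 // exprn_gt0 // invr_gt0.
Qed.

Lemma is_derive_flat k (t : R) :
  is_derive t (1 : R) (flat k) (flat k.+2 t - k%:R * flat k.+1 t).
Proof.
have [t0|t0|->] := ltgtP t 0.
- rewrite !flat_le0 ?(ltW t0) // mulr0 subr0.
  apply: (@near_eq_is_derive _ _ _ (cst 0)).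
  near=> s; rewrite flat_le0 //; apply: ltW; near: s.
  exact: lt_nbhsl.
- pose F u : R := (id ^+ k : R -> R) u * expR (- u).
  apply: (@near_eq_is_derive _ _ _ (F \o (fun s => s^-1))).
    near=> s; have s0 : 0 < s by near: s; exact: lt_nbhsr.
    by rewrite /flat s0 /F /= exprfctE.
  have tN0 : t != 0 by rewrite gt_eqF.
  have dinv : is_derive t (1 : R) (fun s : R => s^-1) (- t ^- 2 *: 1).
    exact: (@is_deriveV R id t 1 1 tN0 (is_derive_id t (1 : R))).
  have dexp : is_derive t^-1 (1 : R) (fun u : R => expR (- u)) (expR (- t^-1) * - 1).
    exact: (is_derive1_comp (is_derive_expR (- t^-1)) (is_deriveNid t^-1 (1 : R))).
  have dF := is_deriveM (is_deriveX k (is_derive_id t^-1 (1 : R))) dexp.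
  apply: is_derive_eq (is_derive1_comp dF dinv) _.
  rewrite /flat t0 /GRing.scale /= !fctE.
  move: (expR _) => E.
  (* both sides are polynomials in u = 1/t times E = exp (-1/t) *)
  rewrite -exprVn; move: t^-1 => u.
  have -> : (u ^+ k * (E * -1) + E * (k%:R * u ^+ k.-1 * 1)) * (- u ^+ 2 * 1) =
     u ^+ k.+2 * E - k%:R * (u ^+ k.+1 * E) :> R; last by [].
  case: k {F dF} => [|k] /=; first by ring.
  rewrite !exprS; move: (k.+1%:R) (u ^+ k) => c w; ring.
rewrite !flat_le0 // mulr0 subr0.
have C0 : (0 : R) < (k.+2)`!%:R by rewrite ltr0n fact_gt0.
have cvg0 : h^-1 *: ((flat k \o shift 0) (h *: (1:R)) - flat k 0)
    @[h --> (0:R)^'] --> (0 : R).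
  apply/cvgr0Pnorm_le => e e0; near=> h.
  have h0 : h != 0 by near: h; exact: nbhs_dnbhs_neq.
  rewrite /= addr0 (flat_le0 _ (lexx 0)) subr0 {1 2}/GRing.scale /= mulr1 normrM normfV.
  rewrite mulrC ler_pdivrMr ?normr_gt0 //.
  apply: le_trans (flat_le_sqr _ _) _.
  rewrite -real_normK ?num_real // expr2 mulrA ler_wpM2r // mulrC -ler_pdivlMr //.
  by near: h; apply: dnbhs0_le; rewrite divr_gt0.
by split; [apply/cvg_ex; exists 0|exact: cvg_lim].
Unshelve. all: by end_near. Qed.

Lemma Ck1B m (g h : R -> R) c : Ck1 m g -> Ck1 m h ->
  Ck1 m (fun t => g t - c * h t).
Proof.
elim: m g h => [|m IH] g h.
  by move=> cg ch t; apply: cvgB; [exact: cg|apply: cvgM (ch t); exact: cvg_cst].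
move=> [g' gg' Cg'] [h' hh' Ch']; exists (fun t => g' t - c * h' t); last exact: IH.
by move=> t; apply: is_deriveB => //; exact: is_deriveZ.
Qed.

Lemma Ck1_flat k m : Ck1 m (flat k).
Proof.
elim: m k => [|m IH] k.
  move=> t; apply: differentiable_continuous; apply/derivable1_diffP.
  by have [] := is_derive_flat k t.
exists (fun t => flat k.+2 t - k%:R * flat k.+1 t); first exact: is_derive_flat.
exact: Ck1B.
Qed.

End flat.

(** * Smooth kernels of matrices of constant rank *)

Section smooth_mx.
Context {R : realType} {n : nat}.
Context (k : nat) (U : set 'rV[R]_n) (oU : open U).

Definition Ck_mx p q (A : 'rV[R]_n -> 'M[R]_(p, q)) :=
  forall i j, Ck k U (fun y => A y i j).

Lemma Ck_mx_cst p q (A : 'M[R]_(p, q)) : Ck_mx (fun=> A).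
Proof. by move=> i j; exact: Ck_cst. Qed.

Lemma Ck_mxM p q s (A : 'rV[R]_n -> 'M[R]_(p, q)) (B : 'rV[R]_n -> 'M[R]_(q, s)) :
  Ck_mx A -> Ck_mx B -> Ck_mx (fun y => A y *m B y).
Proof.
move=> CA CB i j.
apply: (@Ck_ext _ _ _ k U (fun y => \sum_l A y i l * B y l j : R)) => //.
  by move=> y _; rewrite mxE.
by apply: Ck_sum => // l; exact: CkM.
Qed.

Lemma Ck_mxB p q (A B : 'rV[R]_n -> 'M[R]_(p, q)) :
  Ck_mx A -> Ck_mx B -> Ck_mx (fun y => A y - B y).
Proof.
move=> CA CB i j.
apply: (@Ck_ext _ _ _ k U (fun y => A y i j + -1 * B y i j : R)) => //.
  by move=> y _; rewrite !mxE mulN1r.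
by apply: CkD => //; apply: CkM => //; exact: Ck_cst.
Qed.

Lemma Ck_mxZ p q (a : 'rV[R]_n -> R) (A : 'rV[R]_n -> 'M[R]_(p, q)) :
  Ck k U a -> Ck_mx A -> Ck_mx (fun y => a y *: A y).
Proof.
move=> Ca CA i j.
apply: (@Ck_ext _ _ _ k U (fun y => a y * A y i j : R)) => //.
  by move=> y _; rewrite mxE.
exact: CkM.
Qed.

Lemma Ck_det p (A : 'rV[R]_n -> 'M[R]_p) : Ck_mx A -> Ck k U (fun y => \det (A y)).
Proof.
move=> CA; apply: Ck_sum => // s; apply: CkM => //; first exact: Ck_cst.
by apply: Ck_prod => // i; exact: CA.
Qed.

Lemma Ck_adj p (A : 'rV[R]_n -> 'M[R]_p) : Ck_mx A -> Ck_mx (fun y => \adj (A y)).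
Proof.
move=> CA i j.
apply: (@Ck_ext _ _ _ k U (fun y => cofactor (A y) j i)) => //.
  by move=> y _; rewrite mxE.
apply: CkM => //; first exact: Ck_cst.
apply: Ck_det => i' j'.
apply: (@Ck_ext _ _ _ k U (fun y => A y (lift j i') (lift i j'))) => //.
by move=> y _; rewrite !mxE.
Qed.

End smooth_mx.

Section kernel_section.
Context {R : fieldType}.
Context (n m k : nat) (N : 'M[R]_(k, n)) (L : 'M[R]_(m, k)) (v : 'rV[R]_n).

(** A generalised k x k minor: N and L combine the rows and columns of A instead of
selecting some of them. *)
Definition minor_mx (A : 'M[R]_(n, m)) : 'M[R]_k := N *m A *m L.

(** The correction of v by Cramer's rule into the left kernel of A *m L. The inner
bracket already lies there; the outer factor det makes the vector vanish where
the minor is singular, so that it also lies in the kernel of A there. Using the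
adjugate instead of the inverse keeps the expression polynomial in A, hence
smooth without any restriction on the domain. *)
Definition kernel_vect (A : 'M[R]_(n, m)) : 'rV[R]_n :=
  \det (minor_mx A) *:
    (\det (minor_mx A) *: v - v *m A *m L *m \adj (minor_mx A) *m N).

Lemma kernel_vect_ker A : kernel_vect A *m A *m L = 0.
Proof.
rewrite /kernel_vect -!scalemxAl mulmxBl mulmxBl -!scalemxAl.
rewrite -!mulmxA (mulmxA N) -/(minor_mx A) mul_adj_mx mul_mx_scalar.
by rewrite !mulmxA -scalemxAr subrr scaler0.
Qed.

Lemma kernel_vect_id A : minor_mx A = 1%:M -> v *m A = 0 -> kernel_vect A = v.
Proof.
by move=> B1 vA; rewrite /kernel_vect vA !mul0mx subr0 B1 det1 !scale1r.
Qed.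

Lemma kernel_vect_singular A : \det (minor_mx A) = 0 -> kernel_vect A = 0.
Proof. by move=> B0; rewrite /kernel_vect B0 scale0r. Qed.

End kernel_section.

Section coordinates.
Context {R : realType} {n : nat} {M : manifold R n}.
Implicit Types (x : M) (c : chart R n M).

Definition coords_mul m x c (B : 'M[R]_(n, m)) (v : tangent x) : 'rV[R]_m :=
  v c *m B.

Lemma coords_mul_linear m x c (B : 'M[R]_(n, m)) : linear (@coords_mul m x c B).
Proof. by move=> a u v; rewrite /coords_mul mulmxDl -scalemxAl. Qed.

HB.instance Definition _ m x c (B : 'M[R]_(n, m)) :=
  GRing.isLinear.Build R (tangent x) 'rV[R]_m _ (@coords_mul m x c B)
    (@coords_mul_linear m x c B).

Lemma coords_sum x c (I : Type) (s : seq I) (F : I -> tangent x) :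
  (\sum_(i <- s) F i) c = \sum_(i <- s) F i c.
Proof. by apply: (big_morph (fun v : tangent x => v c)). Qed.

Lemma tangent_sum x c (v : tangent x) : chart_around x c ->
  v = \sum_i v c 0 i *: coord_vect c i x.
Proof.
move=> hc; apply: (tangent_eqP hc); rewrite coords_sum [LHS]row_sum_delta.
by apply: eq_bigr => i _; rewrite -[in LHS](tangent_ofE (delta_mx 0 i) hc).
Qed.

Context (tau : one_form M) (om : two_form M).

(** Row i lists tau(e_i) and the omega(e_i, e_j) in the coordinate frame of c, so
that the coordinate rows of vectors of the characteristic distribution form its
left kernel. *)
Definition pair_mx c x : 'M[R]_(n, 1 + n) :=
  row_mx (\col_i (tau x (coord_vect c i x) : R))
    (\matrix_(i, j) (om x (coord_vect c i x) (coord_vect c j x) : R)).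

Lemma mem_char_distribution x c (v : tangent x) : chart_around x c ->
  (v \in char_distribution tau om x) = (v c *m pair_mx c x == 0).
Proof.
move=> hc; rewrite memv_cap !memv_ker mul_mx_row.
have -> : v c *m (\col_i (tau x (coord_vect c i x) : R)) = (tau x v)%:M.
  apply/matrixP => i j; rewrite !ord1 !mxE eqxx mulr1n.
  rewrite [in RHS](tangent_sum v hc) linear_sum; apply: eq_bigr => l _.
  by rewrite linearZ !mxE.
set w := v c *m _.
have wE j : w 0 j = om x v (coord_vect c j x).
  rewrite !mxE [in RHS](tangent_sum v hc) linear_sum sum_lfunE.
  by apply: eq_bigr => l _; rewrite linearZ scale_lfunE !mxE.
have -> : (om x v == 0) = (w == 0).
  apply/eqP/eqP => [ov|w0]; first by apply/rowP => j; rewrite wE ov zero_lfunE mxE.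
  apply/lfunP => u; rewrite zero_lfunE (tangent_sum u hc) linear_sum big1 // => j _.
  by rewrite linearZ /= -wE w0 mxE scaler0.
rewrite row_mx_eq0; congr andb.
apply/eqP/eqP => [->|/matrixP /(_ 0 0)]; first exact: raddf0.
by rewrite !mxE eqxx mulr1n.
Qed.

(** Constancy of the class enters here: where the k x k minor is invertible,
v |-> v A L is onto R^k, so its kernel has the dimension n - k of the
characteristic space, which it contains; the two are therefore equal. *)
Lemma char_minor x c k (N : 'M[R]_(k, n)) (L : 'M[R]_(1 + n, k)) (v : tangent x) :
  chart_around x c -> pair_class tau om x = k ->
  \det (minor_mx N L (pair_mx c x)) != 0 -> v c *m pair_mx c x *m L = 0 ->
  v \in char_distribution tau om x.
Proof.
move=> hc xk B0 vL; set B := minor_mx _ _ _ in B0.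
pose psi := linfun (@coords_mul k x c (pair_mx c x *m L)).
have psiE u : psi u = u c *m pair_mx c x *m L by rewrite lfunE /= /coords_mul mulmxA.
have sub : (char_distribution tau om x <= lker psi)%VS.
  apply/subvP => u; rewrite (mem_char_distribution _ hc) memv_ker psiE => /eqP ->.
  by rewrite mul0mx.
have Bu : B \in unitmx by rewrite unitmxE unitfE.
have onto : limg psi = fullv.
  apply/vspaceP => w; rewrite memvf.
  have -> : w = psi (tangent_of x c (w *m invmx B *m N)).
    by rewrite psiE tangent_ofE // -!mulmxA (mulmxA N) -/(minor_mx N L _) mulVmx // mulmx1.
  exact: memv_img (memvf _).
have := limg_ker_dim psi fullv; rewrite capfv onto dim_tangent dimvf.
have -> : dim 'rV[R]_k = k by rewrite dim_matrix; exact: mul1n.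
move=> dimk.
have -> : char_distribution tau om x = lker psi.
  apply/eqP; rewrite eqEdim sub /=.
  rewrite -(leq_add2r k) dimk -xk /pair_class dim_tangent subnKC //.
  by rewrite -[leqRHS](dim_tangent x) dimvS ?subvf.
by rewrite memv_ker psiE vL.
Qed.

(** The rows of N are the coordinates of a basis of a complement of the
characteristic space; A is injective on it, so N *m A has a right inverse L. *)
Lemma exists_unit_minor x c : chart_around x c ->
  exists (N : 'M[R]_(pair_class tau om x, n)) L, minor_mx N L (pair_mx c x) = 1%:M.
Proof.
move=> hc; rewrite /pair_class -dimv_compl; set K := char_distribution tau om x.
set b := vbasis (K^C).
pose N : 'M[R]_(\dim (K^C), n) := \matrix_i (b`_i : tangent x) c.
suff /row_freeP [L NL] : row_free (N *m pair_mx c x) by exists N, L.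
apply: inj_row_free => w wNA.
pose z := \sum_i w 0 i *: b`_i.
have zc : z c = w *m N.
  rewrite coords_sum mulmx_sum_row; apply: eq_bigr => i _.
  by rewrite rowK.
have zK : z \in K by rewrite (mem_char_distribution _ hc) zc -mulmxA wNA.
have zK' : z \in (K^C)%VS.
  by apply: memv_suml => i _; apply/memvZ/vbasis_mem/mem_nth; rewrite size_tuple.
have : z \in (K :&: K^C)%VS by rewrite memv_cap zK zK'.
rewrite capv_compl memv0 => /eqP z0; apply/rowP => i; rewrite mxE.
have /freeP fb := basis_free (vbasisP (K^C)).
exact: (fb (fun i => w 0 i) z0 i).
Qed.

End coordinates.

(** * Bump functions and global sections *)

Section bump.
Context {R : realType} {n : nat}.
Implicit Types (y : 'rV[R]_n) (e : R).

(** Nonzero at y0 and supported in a box, which is the closed ball of the sup norm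
and is compact as a product of segments. *)
Definition bump y0 e y : R := \prod_i flat 0 (e ^+ 2 - (y 0 i - y0 0 i) ^+ 2).

Lemma Ck_bump y0 e k (U : set 'rV[R]_n) : open U -> Ck k U (bump y0 e).
Proof.
move=> oU; apply: Ck_prod => // i.
apply: (@Ck1_comp _ _ k U (flat 0) (fun y => e ^+ 2 - (y 0 i - y0 0 i) ^+ 2)) => //.
  exact: Ck1_flat.
apply: (@Ck_ext _ _ _ k U
  (fun y => e ^+ 2 + (-1) * ((y 0 i - y0 0 i) * (y 0 i - y0 0 i)) : R)) => //.
  by move=> y _; rewrite mulN1r.
have Cc (a : R) : Ck k U (fun=> a) by exact: Ck_cst.
have Ci : Ck k U (fun y => y 0 i - y0 0 i : R).
  apply: CkD => //; apply: (@Ck_coord _ _ _ k U id) => //.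
  case: k {Cc} => [|k]; first by move=> x _; exact: cvg_id.
  apply: (@CkS _ _ _ _ _ _ (fun=> id)) => // v; exact: Ck_cst.
by apply: CkD => //; apply: CkM => //; exact: CkM.
Qed.

Lemma bump_center y0 e : e != 0 -> bump y0 e y0 != 0.
Proof.
move=> e0; apply/prodf_neq0 => i _; rewrite gt_eqF // flat_gt0 //.
by rewrite subrr expr0n subr0 exprn_even_gt0.
Qed.

Definition box y0 e : set 'rV[R]_n :=
  [set y | forall i, (y0 0 i - e <= y 0 i <= y0 0 i + e)%R].

Lemma bump_out y0 e y : 0 <= e -> ~ box y0 e y -> bump y0 e y = 0.
Proof.
move=> e0 /existsNP [i ni]; apply/eqP; apply/prodf_eq0; exists i => //.
rewrite flat_le0 // subr_le0 -[leRHS]real_normK ?num_real // ler_sqr ?nnegrE //.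
by rewrite leNgt ltr_distl; apply/negP => /andP[a b]; apply: ni; rewrite !ltW.
Qed.

Lemma box_compact y0 e : compact (box y0 e).
Proof.
have := @rV_compact R n (fun i => `[y0 0 i - e, y0 0 i + e]%classic)
   (fun i => @segment_compact _ _ _).
congr compact; apply/seteqP; split=> y yb i; have := yb i; by rewrite /= in_itv.
Qed.

Lemma box_sub y0 (U : set 'rV[R]_n) : open U -> U y0 ->
  exists2 e, 0 < e & box y0 e `<=` U.
Proof.
move=> oU Uy0; have /nbhs_ballP [e /= e0 eU] : nbhs y0 U by exact: open_nbhs_nbhs.
exists (e / 2); first by rewrite divr_gt0.
move=> y yb; apply: eU; split => //= i j; rewrite (ord1 i) /ball /= ltr_distlC.
have /andP[a b] := yb j; apply/andP; split; lra.
Qed.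

End bump.

(** The coordinates of a vector field change by the differential of a transition
map applied to a moving vector; this is the smoothness of that expression. *)
Lemma Ck_diff_app (R : realType) (n m : nat) k (W : set 'rV[R]_n)
    (g : 'rV[R]_n -> 'rV[R]_m) (Y : 'rV[R]_n -> 'rV[R]_n) : open W ->
  Ck k.+1 W g -> Ck k W Y -> Ck k W (fun w => 'd g w (Y w)).
Proof.
move=> oW [_ Cg] CY; apply: Ck_rV => // i.
apply: (@Ck_ext _ _ _ k W
  (fun w => \sum_j Y w 0 j * ('d g w (delta_mx 0 j)) 0 i : R)) => //.
  move=> w _; rewrite [in RHS](row_sum_delta (Y w)) linear_sum summxE.
  by apply: eq_bigr => j _; rewrite linearZ mxE.
apply: Ck_sum => // j; apply: CkM => //; first exact: Ck_coord.
exact: Ck_coord oW (Cg _).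
Qed.

Section globalize.
Context {R : realType} {n : nat} {M : manifold R n}.
Implicit Types (x : M) (c d : chart R n M).

Lemma open_chart_preim c (W : set M) : open W -> open (cimg c `&` cinv c @^-1` W).
Proof.
move=> oW; rewrite openE => y [cy Wy]; apply: filterI.
  by apply: open_nbhs_nbhs; split => //; exact: cimg_open.
by apply: (cinv_continuous cy); exact: open_nbhs_nbhs.
Qed.

Lemma cimg_cdom c d : cimg c `&` cinv c @^-1` (cdom d) = c @` (cdom c `&` cdom d).
Proof.
apply/seteqP; split=> [_ [[x cx <-]] |_ [x [cx dx] <-]].
  by rewrite /preimage /= cmapK // => dx; exists x.
by split; [exists x|rewrite /preimage /= cmapK].
Qed.

Definition extend c (Y : 'rV[R]_n -> 'rV[R]_n) : vector_field M := fun x =>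
  if `[< cdom c x >] then tangent_of x c (Y (c x)) else 0.

(** Over the domain of c the coordinates in another chart d are obtained by a
transition map. Any other point is outside the image of K in M, which is compact,
hence closed as M is Hausdorff, so the field vanishes near that point. *)
Lemma extend_smooth c (Y : 'rV[R]_n -> 'rV[R]_n) (K : set 'rV[R]_n) :
  atlas c -> smooth_on (cimg c) Y -> compact K -> K `<=` cimg c ->
  (forall y, ~ K y -> Y y = 0) -> smooth_vector_field (extend c Y).
Proof.
move=> ac sY cK Kc YK d ad k; apply: Ck_local => _ [z dz <-].
have [cz|ncz] := pselect (cdom c z).
  exists (cimg d `&` cinv d @^-1` (cdom c)).
    by split; [exists z|rewrite /preimage /= cmapK].
  have oV := @open_chart_preim d _ (cdom_open c).
  pose W := cimg c `&` cinv c @^-1` (cdom d).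
  have oW : open W := @open_chart_preim c _ (cdom_open d).
  have Ch : Ck k W (fun w => 'd (transition c d) w (Y w)).
    apply: Ck_diff_app => //; first by rewrite /W cimg_cdom; exact: atlas_compat.
    by apply: Ck_sub (sY k); exact: subIsetl.
  have CT : Ck k (cimg d `&` cinv d @^-1` (cdom c)) (transition d c).
    by rewrite cimg_cdom; exact: atlas_compat.
  apply: (@Ck_ext _ _ _ k _
    (fun y => 'd (transition c d) (transition d c y) (Y (transition d c y)))) => //.
    move=> y [[x dx <-]]; rewrite /preimage /= cmapK // => cx.
    rewrite /extend asboolT // /= /lift_family asboolT; last by split; split.
    by rewrite /transition cmapK.
  apply: Ck_rV => // i.
  apply: (@Ck_comp R n n k _ W (fun w => ('d (transition c d) w (Y w)) 0 i)) => //.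
    move=> y [[x dx <-]]; rewrite /preimage /= /transition cmapK // => cx.
    by split; [exists x|rewrite /preimage /= cmapK].
  exact: Ck_coord.
have clK : closed (cinv c @` K).
  apply: compact_closed; first exact: carrier_hausdorff.
  apply: continuous_compact => //; apply: continuous_in_subspaceT => y.
  by rewrite inE => /Kc cy; exact: cinv_continuous.
exists (cimg d `&` cinv d @^-1` (~` (cinv c @` K))).
  split; first by exists z.
  rewrite /preimage /= cmapK // => -[y Ky yz]; apply: ncz.
  by have [x cx xy] := Kc _ Ky; rewrite -yz -xy cmapK.
apply: (@Ck_ext _ _ _ k _ (fun=> 0)); last exact: Ck_cst.
  by apply: open_chart_preim; exact: closed_openC.
move=> y [_ nK]; rewrite /extend; case: asboolP => // cx.
rewrite YK; last by move=> KY; apply: nK; exists (c (cinv d y)) => //; rewrite cmapK.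
by rewrite /= /lift_family linear0 if_same.
Qed.

Lemma extend_eq c Y x : cdom c x -> extend c Y x = tangent_of x c (Y (c x)).
Proof. by move=> cx; rewrite /extend asboolT. Qed.

Lemma extend_out c Y x : ~ cdom c x -> extend c Y x = 0.
Proof. by move=> cx; rewrite /extend asboolF. Qed.

(** The characteristic distribution of a doublet, having constant rank, is spanned
by its global smooth sections: a cut-off of the local section [kernel_vect] takes
at x0 a nonzero multiple of the prescribed value v. *)
Lemma char_section (tau : one_form M) (om : two_form M) k x0
    (v : tangent x0) : doublet_of_class k tau om ->
  v \in char_distribution tau om x0 ->
  exists2 X : vector_field M,
    smooth_vector_field X /\ (forall x, X x \in char_distribution tau om x)
    & exists2 a, a != 0 & X x0 = a *: v.
Proof.
move=> [stau [_ som] cls] vK.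
pose c := chart_at x0; have hc : chart_around x0 c := chart_atP x0.
have [ac cx0] := hc.
have [N [L NL1]] := exists_unit_minor tau om hc.
have oU := @cimg_open _ _ _ c.
have [e e0 eU] : exists2 e, 0 < e & box (c x0) e `<=` cimg c.
  by apply: box_sub => //; exists x0.
pose A y := pair_mx tau om c (cinv c y).
pose Y y := bump (c x0) e y *: kernel_vect N L (v c) (A y).
have CA m : Ck_mx m (cimg c) A.
  move=> i j; case: (split_ordP j) => j' ->.
    apply: (@Ck_ext _ _ _ m _
      (fun y => tau (cinv c y) (coord_vect c i (cinv c y)) : R)) => //.
      by move=> y _; rewrite /A /pair_mx row_mxEl mxE.
    exact: stau.
  apply: (@Ck_ext _ _ _ m _ (fun y => om (cinv c y)
    (coord_vect c i (cinv c y)) (coord_vect c j' (cinv c y)) : R)) => //.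
    by move=> y _; rewrite /A /pair_mx row_mxEr mxE.
  exact: som.
have sY : smooth_on (cimg c) Y.
  move=> m; apply: Ck_rV => // i; apply: Ck_mxZ => //; first exact: Ck_bump.
  have CB : Ck_mx m (cimg c) (fun y => minor_mx N L (A y)).
    apply: (Ck_mxM oU); last exact: Ck_mx_cst.
    by apply: (Ck_mxM oU) => //; exact: Ck_mx_cst.
  apply: Ck_mxZ => //; first exact: Ck_det.
  apply: Ck_mxB => //; first by apply: Ck_mxZ; [|exact: Ck_det|exact: Ck_mx_cst].
  apply: (Ck_mxM oU); last exact: Ck_mx_cst.
  apply: (Ck_mxM oU); last exact: Ck_adj.
  apply: (Ck_mxM oU); last exact: Ck_mx_cst.
  by apply: (Ck_mxM oU) => //; exact: Ck_mx_cst.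
have smX : smooth_vector_field (extend c Y).
  apply: (extend_smooth ac sY (@box_compact _ _ (c x0) e) eU) => y nb.
  by rewrite /Y bump_out ?scale0r // ltW.
exists (extend c Y).
  split=> // x; have [cx|ncx] := pselect (cdom c x); last by rewrite extend_out // mem0v.
  rewrite extend_eq //; have hcx : chart_around x c by split.
  have AE : A (c x) = pair_mx tau om c x by rewrite /A cmapK.
  rewrite (mem_char_distribution _ _ _ hcx) tangent_ofE // /Y AE -scalemxAl.
  rewrite scaler_eq0; apply/orP; right.
  have [B0|B0] := eqVneq (\det (minor_mx N L (pair_mx tau om c x))) 0.
    by rewrite kernel_vect_singular // mul0mx.
  rewrite -[kernel_vect _ _ _ _](tangent_ofE _ hcx) -mem_char_distribution //.
  apply: char_minor hcx _ B0 _; first by rewrite !cls.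
  by rewrite tangent_ofE // kernel_vect_ker.
exists (bump (c x0) e (c x0)); first by rewrite bump_center // gt_eqF.
apply: (tangent_eqP hc); rewrite extend_eq // tangent_ofE // /Y.
rewrite kernel_vect_id // /A cmapK //.
by apply/eqP; rewrite -mem_char_distribution.
Qed.

End globalize.

(** * The perturbed pair *)

Section perturb.
Context {R : realType} {n : nat} {M : manifold R n}.
Context (tau : one_form M) (om : two_form M) (f : M -> R).
Context (sf : smooth_function f) (stau : smooth_one_form tau).
Context (som : smooth_two_form om).

Lemma smooth_expR_function c : atlas c ->
  smooth_on (cimg c) (fun y => expR (f (cinv c y)) : R).
Proof.
move=> ac k; apply: (@Ck1_comp _ _ k _ expR); [exact: cimg_open|exact: Ck1_expR|exact: sf].
Qed.

Lemma smooth_differential : smooth_one_form (differential f).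
Proof.
move=> c ac i k; have oU := @cimg_open _ _ _ c.
have [_ Cdf] := sf ac k.+1.
apply: Ck_ext (Cdf (delta_mx 0 i)) => // _ [x cx <-].
have hc : chart_around x c by split.
by rewrite cmapK // (differentialE _ sf hc) tangent_ofE.
Qed.

Lemma smooth_scaled_one_form : smooth_one_form (fun x => expR (f x) *: tau x).
Proof.
move=> c ac i k; have oU := @cimg_open _ _ _ c.
apply: (@Ck_ext _ _ _ k _ (fun y => expR (f (cinv c y)) *
    tau (cinv c y) (coord_vect c i (cinv c y)) : R)) => //.
  by move=> y _; rewrite scale_lfunE.
by apply: CkM => //; [exact: smooth_expR_function|exact: stau].
Qed.

Lemma smooth_perturbed_two_form : smooth_two_form
  (fun x => expR (f x) *: (wedge (differential f x) (tau x) + om x)).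
Proof.
have [alt sc] := som; split=> [x u|c ac i j k].
  by rewrite scale_lfunE add_lfunE scale_lfunE add_lfunE wedgeE alt subrr addr0 scaler0.
have oU := @cimg_open _ _ _ c.
pose t l y : R := tau (cinv c y) (coord_vect c l (cinv c y)).
pose d l y : R := differential f (cinv c y) (coord_vect c l (cinv c y)).
apply: (@Ck_ext _ _ _ k _ (fun y => expR (f (cinv c y)) *
    (d i y * t j y + (-1) * (d j y * t i y) +
     om (cinv c y) (coord_vect c i (cinv c y)) (coord_vect c j (cinv c y))) : R)) => //.
  by move=> y _; rewrite scale_lfunE add_lfunE scale_lfunE add_lfunE wedgeE mulN1r.
apply: CkM => //; first exact: smooth_expR_function.
have Ct l : Ck k (cimg c) (t l) by exact: stau.
have Cd l : Ck k (cimg c) (d l) by exact: smooth_differential.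
apply: CkD => //; last exact: sc.
apply: CkD => //; first exact: CkM.
by apply: CkM => //; [exact: Ck_cst|exact: CkM].
Qed.

End perturb.

Theorem proposition6p13 (R : realType) (n : nat) (M : manifold R n) (r : nat)
    (tau : one_form M) (omega : two_form M) (f : M -> R)
    (doublet_tau_omega : doublet_of_class (2 * r + 1)%N tau omega)
    (smooth_f : smooth_function f) :
  doublet_of_class (2 * r + 1)%N
    (fun x => expR (f x) *: tau x)
    (fun x => expR (f x) *: (wedge (differential f x) (tau x) + omega x))
  <->
  (forall Gamma : vector_field M,
     smooth_vector_field Gamma ->
     (forall x, Gamma x \in char_distribution tau omega x) ->
     forall x, lie_derivative Gamma f x = 0).
Proof.
have [stau som cls] := doublet_tau_omega; have [alt _] := som.
set tau' := fun x => expR (f x) *: tau x.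
set omega' := fun x => _.
have kerE x : char_distribution tau' omega' x =
    (char_distribution tau omega x :&: lker (differential f x))%VS.
  apply: ker_perturbed; rewrite ?gt_eqF ?expR_gt0 //; first exact: alt.
  have := cls x; rewrite /pair_class => ->.
  by rewrite addn1 /= mul2n odd_double.
split=> [[_ _ cls'] Gamma _ GK x|ann].
  (* K' lies in K, and the equality of classes makes their dimensions equal *)
  suff KE : char_distribution tau' omega' x = char_distribution tau omega x.
    by have := GK x; rewrite -KE kerE memv_cap memv_ker => /andP[_ /eqP].
  apply/eqP; rewrite eqEdim {1}kerE capvSl /=.
  have := cls' x; rewrite -(cls x) /pair_class => dimE.
  rewrite -(subKn (dimvS (subvf (char_distribution tau omega x)))).
  by rewrite -dimE subKn ?dimvS ?subvf.
split=> [||x]; first exact: smooth_scaled_one_form.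
  exact: smooth_perturbed_two_form.
rewrite /pair_class kerE (capv_idPl _); first exact: cls.
apply/subvP => v vK; rewrite memv_ker.
have [X [sX XK] [a a0 Xx]] := char_section doublet_tau_omega vK.
have := ann X sX XK x; rewrite /lie_derivative Xx linearZ => /eqP.
by rewrite scaler_eq0 (negPf a0).
Qed.
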